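(* Let $\{C_\alpha(X):\alpha\in[0,1]\}$ be a family of confidence sets satisfying: (i) Nestedness: if $\alpha_1<\alpha_2$ then $C_{\alpha_2}(X)\subseteq C_{\alpha_1}(X)$ a.s.; (ii) Nominal coverage: for all $\theta\in\Theta$ and $\alpha\in[0,1]$, $P_\theta\{\theta\in C_\alpha(X)\}\ge1-\alpha$; (iii) Unbiasedness: for all $\theta,\vartheta\in\Theta$ and $\alpha\in[0,1]$, $P_\theta\{\theta\in C_\alpha(X)\}\ge P_\vartheta\{\theta\in C_\alpha(X)\}$. Define a contour by stacking, $\pi_X(\vartheta):=\sup\{\alpha\in[0,1]:\vartheta\in C_\alpha(X)\}$. Assume the mild boundary regularity that, for each fixed $\vartheta$, the map $\alpha\mapsto 1\{\vartheta\in C_\alpha(X)\}$ is a.s. left-continuous (equivalently, the $C_\alpha(X)$ can be taken closed). Then: (a) the $\alpha$-cuts recover the confidence sets: $\{\vartheta:\pi_X(\vartheta)\ge\alpha\}=C_\alpha(X)$ a.s. for all $\alpha$; (b) the contour is strongly valid: $P_\theta\{\pi_X(\theta)<\alpha\}\le\alpha$ for all $\theta,\alpha$; (c) the induced possibility measure is unbiased, i.e. $P_\theta\{\pi_X(\theta)\le\alpha\}\le P_\vartheta\{\pi_X(\theta)\le\alpha\}$ for all $\theta,\vartheta\in\Theta$ and all $\alpha\in[0,1]$. Conversely, if a contour $\pi_X$ is valid and possibilistically unbiased, then its $\alpha$-cuts $A_\alpha(X)=\{\vartheta:\pi_X(\vartheta)\ge\alpha\}$ form a nested family of confidence sets satisfying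 the nominal coverage and unbiasedness conditions (ii) and (iii) (with $C_\alpha=A_\alpha$).
   Context: $\{P_\theta:\theta\in\Theta\}$ is a statistical model for data $X$. A data-dependent possibility measure $\Pi_x$ is determined by its contour $\pi_x:\Theta\to[0,1]$ via $\Pi_x(B)=\sup_{\vartheta\in B}\pi_x(\vartheta)$. The contour is valid (equivalently here, strongly valid) if $P_\theta\{\pi_X(\theta)<\alpha\}\le\alpha$ for all $\theta\in\Theta$, $\alpha\in[0,1]$. It is (possibilistically) unbiased if for every fixed $\theta$ the random variable $\pi_X(\theta)$ is stochastically largest under $P_\theta$, i.e. $P_\theta\{\pi_X(\theta)\le\alpha\}\le P_\vartheta\{\pi_X(\theta)\le\alpha\}$ for all $\vartheta\in\Theta$ and all $\alpha\in[0,1]$.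
   Formalization: In (a), equality at α=0 assumes C_0(X) contains ϑ (is all of Θ); equality of sets a.s. assumes left-continuity holds off one null set common to all ϑ, otherwise equality is for each fixed ϑ. Without these (a) can fail. Membership events and π_X(ϑ) are assumed measurable. *)

(* Defs.v *)
From mathcomp Require Export all_boot all_order all_algebra.
From mathcomp Require Export all_classical all_reals all_analysis.

Export Order.TTheory GRing.Theory Num.Theory.
Export numFieldNormedType.Exports.

Set Implicit Arguments.
Unset Strict Implicit.
Unset Printing Implicit Defensive.

Local Open Scope classical_set_scope.
Local Open Scope ring_scope.

(* T is the sample space of the data X, so that events about X are subsets of
   T, and P theta is the law of X.  A family of random subsets of Theta is a
   function C with C alpha x the realization of C_alpha(X) at X = x; only the
   indices alpha in [0, 1] are ever used.  A data-dependent contour is a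
   function pi with pi x theta = pi_x(theta).  "a.s." means P theta-almost
   surely for every theta. *)

Section Model.
Context {R : realType} {d : measure_display} {T : measurableType d}.
Context {Theta : Type}.
Implicit Types (P : Theta -> probability T R) (C : R -> T -> set Theta).
Implicit Types (pi : T -> Theta -> R).

Definition level (alpha : R) : Prop := 0 <= alpha <= 1.

Definition measurable_membership C : Prop :=
  forall alpha theta, level alpha -> measurable [set x | C alpha x theta].

Definition nested P C : Prop :=
  forall alpha1 alpha2, level alpha1 -> level alpha2 -> alpha1 < alpha2 ->
  forall theta, {ae P theta, forall x, C alpha2 x `<=` C alpha1 x}.

Definition nominal_coverage P C : Prop :=
  forall theta alpha, level alpha ->
  ((1 - alpha)%:E <= P theta [set x | C alpha x theta])%E.

Definition unbiased_sets P C : Prop :=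
  forall theta vartheta alpha, level alpha ->
  (P vartheta [set x | C alpha x theta] <= P theta [set x | C alpha x theta])%E.

(* Left-continuity on [0, 1] of alpha |-> 1{vartheta \in C_alpha(x)}; there is
   no condition at the left endpoint. *)
Definition left_continuous_at C (x : T) (vartheta : Theta) : Prop :=
  forall alpha, 0 < alpha <= 1 ->
  (fun a : R => \1_(C a x) vartheta : R) @ alpha^'- -->
    (\1_(C alpha x) vartheta : R).

(* The supremum is taken in [0, 1]: it is 0 when no C_alpha(x) contains
   vartheta, in agreement with sup set0 = 0. *)
Definition stacked C : T -> Theta -> R :=
  fun x vartheta => sup [set alpha : R | level alpha /\ C alpha x vartheta].

Definition alpha_cut pi : R -> T -> set Theta :=
  fun alpha x => [set vartheta | alpha <= pi x vartheta].

Definition is_contour pi : Prop :=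
  forall x theta, 0 <= pi x theta <= 1.

Definition measurable_contour pi : Prop :=
  forall theta, measurable_fun [set: T] (fun x => pi x theta).

Definition valid P pi : Prop :=
  forall theta alpha, level alpha ->
  (P theta [set x | (pi x theta < alpha)%R] <= alpha%:E)%E.

Definition possibilistically_unbiased P pi : Prop :=
  forall theta vartheta alpha, level alpha ->
  (P theta [set x | (pi x theta <= alpha)%R] <=
   P vartheta [set x | (pi x theta <= alpha)%R])%E.

End Model.

(* Main.v *)
Require Import Defs.
From mathcomp Require Import all_boot all_order all_algebra.
From mathcomp Require Import all_classical all_reals all_analysis.

Local Open Scope classical_set_scope.
Local Open Scope ring_scope.

(** The point is that, off a null set, the family of confidence sets is nested
    for all pairs of levels at once and its membership indicators are
    left-continuous, so that stacking loses nothing.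

    Nestedness is only assumed with a null set for each pair of levels.  There
    are countably many pairs of rational levels, so one null set serves them
    all, and left-continuity carries nestedness from rational to real levels
    ([rational_nested_monotone]).  At such a sample point the set of levels
    whose confidence set contains vartheta is empty or an interval from [0] to
    its supremum, and left-continuity makes it contain the supremum when that
    is positive; hence [stacked C x vartheta >= alpha] exactly when
    [C alpha x vartheta], for [0 < alpha <= 1] ([alpha_cut_stackedP]).

    Consequently [stacked C] has the upper-tail probabilities
    [P theta {stacked C >= alpha} = P theta (C alpha)] for [0 < alpha <= 1].
    Validity is the complement of nominal coverage.  Unbiasedness of the sets
    compares the events [{pi >= alpha}], that of the contour the events
    [{pi <= alpha}]; after taking complements the two differ only in whether
    the inequality is strict, and continuity from below of the measures
    bridges this gap in both directions ([le_probability_lt]). *)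

(** * Comparison of probabilities *)

Section Probability.
Set Implicit Arguments.
Unset Strict Implicit.
Context {R : realType} {d : measure_display} {T : measurableType d}.

Lemma measurable_set_ler (f : T -> R) (a : R) :
  measurable_fun [set: T] f -> measurable [set x | f x <= a].
Proof.
move=> mf; rewrite -[X in measurable X]setTI.
exact: (measurable_fun_le measurableT mf (measurable_cst a)).
Qed.

Lemma measurable_set_ger (f : T -> R) (a : R) :
  measurable_fun [set: T] f -> measurable [set x | a <= f x].
Proof.
move=> mf; rewrite -[X in measurable X]setTI.
exact: (measurable_fun_le measurableT (measurable_cst a) mf).
Qed.

Lemma setC_ltr (f : T -> R) (a : R) :
  ~` [set x | f x < a] = [set x | a <= f x].
Proof.
by apply/seteqP; split=> x /=; rewrite leNgt; [move/negP | move=> /negP].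
Qed.

Lemma measurable_set_ltr (f : T -> R) (a : R) :
  measurable_fun [set: T] f -> measurable [set x | f x < a].
Proof.
move=> mf; rewrite -[X in measurable X]setCK setC_ltr.
exact/measurableC/measurable_set_ger.
Qed.

Lemma setC_ler (f : T -> R) (a : R) :
  ~` [set x | f x <= a] = [set x | a < f x].
Proof.
by apply/seteqP; split=> x /=; rewrite ltNge; [move/negP | move=> /negP].
Qed.

Lemma le_measure_ae (mu : {measure set T -> \bar R}) (A B : set T) :
  measurable A -> measurable B -> {ae mu, forall x, A x -> B x} ->
  (mu A <= mu B)%E.
Proof.
move=> mA mB AB; have mAB : measurable (A `\` B) by exact: measurableD.
have AB0 : mu (A `\` B) = 0%E.
  apply/negligibleP => //; apply: negligibleS AB => x /= [Ax nBx] ABx.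
  exact/nBx/ABx.
have ABB : (mu (B `|` (A `\` B)) <= mu B)%E.
  by rewrite -[leRHS]adde0 -[X in (_ + X)%E]AB0; exact: measureU2.
apply: le_trans ABB; apply: le_measure; rewrite ?inE//; first exact: measurableU.
by move=> x Ax; have [Bx|nBx] := pselect (B x); [left | right].
Qed.

Lemma le_probability_setC (P Q : probability T R) (A : set T) :
  measurable A -> (P A <= Q A)%E -> (Q (~` A) <= P (~` A))%E.
Proof. by move=> mA PQ; rewrite !probability_setC// leeB. Qed.

(** The half-line [f < a] is the increasing union of the half-lines
    [f <= a - (n + 1)^-1], so that a comparison of the latter passes to the
    limit. *)
Lemma le_probability_lt (P Q : probability T R) (f : T -> R) (a : R) :
  measurable_fun [set: T] f ->
  (forall b, b < a -> (P [set x | (f x <= b)%R] <= Q [set x | (f x <= b)%R])%E) ->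
  (P [set x | (f x < a)%R] <= Q [set x | (f x < a)%R])%E.
Proof.
move=> mf PQ.
pose F (n : nat) := [set x | f x <= a - n.+1%:R^-1].
have FE : [set x | f x < a] = \bigcup_n F n.
  apply/seteqP; split=> [x /= fxa|x [n _] /=].
    by have [k fk] := ltr_add_invr fxa; exists k => //=; rewrite /F/= lerBrDr ltW.
  by move/le_lt_trans; apply; rewrite ltrBlDr ltrDl invr_gt0.
have mF n : measurable (F n) by exact: measurable_set_ler.
have ndF : {homo F : n m / (n <= m)%N >-> (n <= m)%O}.
  move=> n m nm; apply/subsetPset => x /= /le_trans; apply.
  by rewrite lerD2l lerN2 lef_pV2 ?posrE// ler_nat.
have cvgF (mu : probability T R) : mu (F n) @[n --> \oo] --> mu (\bigcup_n F n).
  by apply: nondecreasing_cvg_mu => //; exact: bigcupT_measurable.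
rewrite FE; apply: (lee_cvg_to (cvgF P) (cvgF Q)).
by apply: nearW => n; apply: PQ; rewrite ltrBlDr ltrDl invr_gt0.
Qed.

End Probability.

(** * Stacking at one sample point *)

Section Stacking.
Set Implicit Arguments.
Unset Strict Implicit.
Context {R : realType} {d : measure_display} {T : measurableType d}.
Context {Theta : Type}.
Implicit Types (C : R -> T -> set Theta) (x : T) (vartheta : Theta).

Lemma stacked_itv C x vartheta : 0 <= stacked C x vartheta <= 1.
Proof.
rewrite /stacked; set S := [set _ | _].
have [->|/set0P[a Sa]] := eqVneq S set0; first by rewrite sup0 lexx ler01.
have ubS : ubound S 1 by move=> b [/andP[]].
apply/andP; split; last by apply: ge_sup => //; exists a.
by apply: (le_trans _ (ub_le_sup _ Sa)); [case: Sa => /andP[] | exists 1].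
Qed.

Lemma left_continuous_at_near C x vartheta (a : R) :
  left_continuous_at C x vartheta -> 0 < a <= 1 ->
  \forall b \near a^'-, C b x vartheta <-> C a x vartheta.
Proof.
move=> lc /lc /cvgrPdist_lt/(_ 1 ltr01); apply: filterS => b.
rewrite !indicE; have [Ca|nCa] := pselect (C a x vartheta);
  have [Cb|nCb] := pselect (C b x vartheta) => //.
- by rewrite mem_set// memNset// subr0 normr1 ltxx.
- by rewrite memNset// mem_set// sub0r normrN1 ltxx.
Qed.

(** Membership at [a] can be tested at a rational level as close to [a] from
    the left as needed. *)
Lemma left_continuous_at_rat C x vartheta (a c : R) :
  left_continuous_at C x vartheta -> 0 < a <= 1 -> c < a ->
  exists q : rat, [/\ c < ratr q, ratr q < a &
    C (ratr q) x vartheta <-> C a x vartheta].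
Proof.
move=> lc a01 ca.
have [e /= e0 He] := left_continuous_at_near lc a01.
have [q] : exists q : rat, ratr q \in `]Num.max c (a - e), a[.
  by apply: rat_in_itvoo; rewrite gt_max ca ltrBlDr ltrDl.
rewrite in_itv/= gt_max => /andP[/andP[cq aeq] qa]; exists q; split => //.
by apply: He => //=; rewrite gtr0_norm ?subr_gt0// ltrBlDr addrC -ltrBlDr.
Qed.

Lemma rational_nested_monotone C x vartheta :
  (forall q1 q2 : rat, level (ratr q1 : R) -> level (ratr q2 : R) ->
     ratr q1 < ratr q2 :> R ->
     C (ratr q2) x vartheta -> C (ratr q1) x vartheta) ->
  left_continuous_at C x vartheta ->
  forall a1 a2, level a1 -> level a2 -> a1 < a2 ->
    C a2 x vartheta -> C a1 x vartheta.
Proof.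
move=> nq lc a1 a2 /andP[a10 a11] /andP[a20 a21] a12.
have a2_gt0 : 0 < a2 by exact: le_lt_trans a12.
have [|q2 [a1q2 q2a2 <-]] := left_continuous_at_rat lc _ a12.
  by rewrite a2_gt0.
have lq2 : level (ratr q2 : R).
  by rewrite /level (ltW (le_lt_trans a10 a1q2)) (le_trans (ltW q2a2)).
have [a1_eq0|a1_neq0] := eqVneq a1 0.
  (* there is nothing to the left of level 0, but 0 itself is rational *)
  rewrite a1_eq0 -(rmorph0 (@ratr R)); apply: nq => //.
    by rewrite /level rmorph0 lexx ler01.
  by rewrite rmorph0 -a1_eq0.
have a1_gt0 : 0 < a1 by rewrite lt_neqAle eq_sym a1_neq0.
have [|q1 [q10 q1a1 <-]] := left_continuous_at_rat lc _ a1_gt0.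
  by rewrite a1_gt0.
apply: nq => //; last exact: lt_trans a1q2.
by rewrite /level (ltW q10) (le_trans (ltW q1a1)).
Qed.

(** The cut at level [0] is everything, whatever [C 0] is, so that [alpha] has
    to be positive. *)
Lemma alpha_cut_stackedP C x vartheta (alpha : R) :
  (forall a1 a2, level a1 -> level a2 -> a1 < a2 ->
    C a2 x vartheta -> C a1 x vartheta) ->
  left_continuous_at C x vartheta -> 0 < alpha <= 1 ->
  alpha_cut (stacked C) alpha x vartheta <-> C alpha x vartheta.
Proof.
move=> mono lc /[dup] alpha01 /andP[alpha0 alpha1]; rewrite /alpha_cut/stacked/=.
set S := [set _ | _].
split=> [le_sup|Ca]; last first.
  apply: ub_le_sup; first by exists 1 => b [/andP[]].
  by split => //; rewrite /level ltW.
have [q [q0 qa <-]] := left_continuous_at_rat lc alpha01 alpha0.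
have S0 : S !=set0.
  apply/set0P/eqP => S0; move: le_sup.
  by rewrite S0 sup0 leNgt alpha0.
have [b [lb Cb] qb] := sup_gt S0 (lt_le_trans qa le_sup).
apply: mono qb Cb => //; by rewrite /level (ltW q0) (le_trans (ltW qa)).
Qed.

End Stacking.

(** * Stacked confidence sets under the model *)

Section AlmostSurely.
Set Implicit Arguments.
Unset Strict Implicit.
Context {R : realType} {d : measure_display} {T : measurableType d}.
Context {Theta : Type}.
Implicit Types (P : Theta -> probability T R) (C : R -> T -> set Theta).

(** One null set for all pairs of rational levels. *)
Lemma nested_rational_ae P C theta : nested P C ->
  {ae P theta, forall x, forall q1 q2 : rat,
     level (ratr q1 : R) -> level (ratr q2 : R) ->
     ratr q1 < ratr q2 :> R -> C (ratr q2) x `<=` C (ratr q1) x}.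
Proof.
move=> nC.
pose good (p : rat * rat) x := level (ratr p.1 : R) -> level (ratr p.2 : R) ->
  ratr p.1 < ratr p.2 :> R -> C (ratr p.2) x `<=` C (ratr p.1) x.
have good_ae (n : nat) :
    {ae P theta, forall x, if unpickle n is Some p then good p x else True}.
  case: (unpickle n) => [[q1 q2]|]; last exact: nearW.
  have [[[l1 l2] q12]|nl] :=
    pselect ((level (ratr q1 : R) /\ level (ratr q2 : R)) /\
             ratr q1 < ratr q2 :> R).
    by apply: filterS (nC _ _ l1 l2 q12 theta) => x Cx _ _ _.
  by apply: nearW => x l1 l2 q12; exfalso; apply: nl.
apply: filterS (ae_foralln good_ae) => x goodx q1 q2.
by have := goodx (pickle (q1, q2)); rewrite pickleK.
Qed.

Lemma alpha_cut_stacked_ae P C theta vartheta : nested P C ->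
  {ae P theta, forall x, left_continuous_at C x vartheta} ->
  {ae P theta, forall x, forall alpha, 0 < alpha <= 1 ->
     (alpha_cut (stacked C) alpha x vartheta <-> C alpha x vartheta)}.
Proof.
move=> nC lc; apply: filterS2 (nested_rational_ae theta nC) lc => x nx lcx.
move=> alpha alpha01; apply: alpha_cut_stackedP => //.
by apply: rational_nested_monotone => // q1 q2 l1 l2 q12; exact: nx.
Qed.

Lemma probability_alpha_cut_stacked P C theta vartheta alpha :
  measurable_membership C -> measurable_contour (stacked C) -> nested P C ->
  {ae P theta, forall x, left_continuous_at C x vartheta} ->
  0 < alpha <= 1 ->
  P theta [set x | (alpha <= stacked C x vartheta)%R] =
  P theta [set x | C alpha x vartheta].
Proof.
move=> mC mS nC lc alpha01.
have level_alpha : level alpha by case/andP: alpha01 => /ltW a0 a1; apply/andP.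
have mA : measurable [set x | alpha <= stacked C x vartheta].
  exact: measurable_set_ger.
apply/eqP; rewrite eq_le; apply/andP; split; apply: le_measure_ae => //;
  try exact: mC.
- by apply: filterS (alpha_cut_stacked_ae nC lc) => x /(_ _ alpha01)[].
- by apply: filterS (alpha_cut_stacked_ae nC lc) => x /(_ _ alpha01)[].
Qed.

Lemma stacked_valid P C :
  measurable_membership C -> measurable_contour (stacked C) -> nested P C ->
  nominal_coverage P C ->
  (forall theta, {ae P theta, forall x, left_continuous_at C x theta}) ->
  valid P (stacked C).
Proof.
move=> mC mS nC cov lc theta alpha /[dup] lalpha /andP[alpha0 alpha1].
have [->|alpha_neq0] := eqVneq alpha 0.
  rewrite (_ : [set x | _] = set0) ?measure0//.
  apply/seteqP; split => x //=; have /andP[s0 _] := stacked_itv C x theta.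
  by rewrite ltNge s0.
have alpha01 : 0 < alpha <= 1 by rewrite lt_neqAle eq_sym alpha_neq0 alpha0.
have := cov theta alpha lalpha.
rewrite -(probability_alpha_cut_stacked mC mS nC (lc theta) alpha01) => cov1.
rewrite -[X in P theta X]setCK setC_ltr probability_setC; last first.
  exact: measurable_set_ger.
apply: le_trans (leeB (lexx 1%E) cov1) _.
by rewrite -EFinB opprB addrCA subrr addr0.
Qed.

Lemma stacked_unbiased P C :
  measurable_membership C -> measurable_contour (stacked C) -> nested P C ->
  unbiased_sets P C ->
  (forall vartheta theta,
    {ae P theta, forall x, left_continuous_at C x vartheta}) ->
  possibilistically_unbiased P (stacked C).
Proof.
move=> mC mS nC uC lc theta vartheta alpha /andP[alpha0 alpha1].
rewrite -[X in P theta X]setCK -[X in P vartheta X]setCK.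
apply: le_probability_setC; first exact/measurableC/measurable_set_ler.
rewrite setC_ler.
(* upper tails of the contour are lower tails of its opposite *)
rewrite (_ : [set x | alpha < _] = [set x | - stacked C x theta < - alpha]);
  last by apply/seteqP; split=> x /=; rewrite ltrN2.
apply: le_probability_lt => [|b b_alpha]; first exact: measurableT_comp.
rewrite (_ : [set x | _ <= b] = [set x | - b <= stacked C x theta]);
  last by apply/seteqP; split=> x /=; rewrite lerNl.
have Nb0 : 0 < - b by rewrite (le_lt_trans alpha0)// ltrNr.
have [b1|b1] := lerP (- b) 1; last first.
  rewrite (_ : [set x | _] = set0) ?measure0//.
  apply/seteqP; split => x //=; have /andP[_ s1] := stacked_itv C x theta.
  by move/(lt_le_trans b1); rewrite ltNge s1.
rewrite !probability_alpha_cut_stacked ?Nb0//.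
by apply: uC; rewrite /level (ltW Nb0).
Qed.

(** * Cuts of a contour *)

Implicit Types (pi : T -> Theta -> R).

Lemma alpha_cut_nested P pi : nested P (alpha_cut pi).
Proof.
move=> a1 a2 _ _ a12 theta; apply: nearW => x vartheta.
exact/le_trans/ltW.
Qed.

Lemma alpha_cut_coverage P pi :
  measurable_contour pi -> valid P pi -> nominal_coverage P (alpha_cut pi).
Proof.
move=> mpi vpi theta alpha lalpha; rewrite /alpha_cut/= -setC_ltr.
rewrite probability_setC; last exact: measurable_set_ltr.
by rewrite EFinB leeB// vpi.
Qed.

Lemma alpha_cut_unbiased P pi :
  is_contour pi -> measurable_contour pi -> possibilistically_unbiased P pi ->
  unbiased_sets P (alpha_cut pi).
Proof.
move=> cpi mpi upi theta vartheta alpha /andP[_ alpha1].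
rewrite /alpha_cut/= -setC_ltr.
apply: le_probability_setC; first exact: measurable_set_ltr.
apply: le_probability_lt => // b b_alpha.
have [b0|b0] := lerP 0 b.
  by apply: upi; rewrite /level b0 (le_trans (ltW b_alpha)).
rewrite (_ : [set x | _] = set0) ?measure0//.
apply/seteqP; split => x //=; have /andP[s0 _] := cpi x theta.
by move/le_lt_trans => /(_ _ b0); rewrite ltNge s0.
Qed.

End AlmostSurely.


Theorem proposition4p1 (R : realType) (d : measure_display)
    (T : measurableType d) (Theta : Type) (P : Theta -> probability T R) :
  (forall C : R -> T -> set Theta,
     measurable_membership C ->
     measurable_contour (stacked C) ->
     nested P C ->
     nominal_coverage P C ->
     unbiased_sets P C ->
     (forall vartheta theta : Theta,
        {ae P theta, forall x, left_continuous_at C x vartheta}) ->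
     [/\ is_contour (stacked C),
         (* (a), for each vartheta *)
         forall vartheta theta : Theta,
           {ae P theta, forall x, forall alpha : R, level alpha ->
              (alpha = 0 -> C 0 x vartheta) ->
              (alpha_cut (stacked C) alpha x vartheta <-> C alpha x vartheta)},
         (* (a), as an equality of sets, when the exceptional null set of the
            left-continuity assumption does not depend on vartheta *)
         forall theta : Theta,
           {ae P theta, forall x, forall vartheta,
              left_continuous_at C x vartheta} ->
           {ae P theta, forall x, forall alpha : R, level alpha ->
              (alpha = 0 -> C 0 x = [set: Theta]) ->
              alpha_cut (stacked C) alpha x = C alpha x},
         (* (b) *)
         valid P (stacked C)
       & (* (c) *)
         possibilistically_unbiased P (stacked C)])
  /\
  (forall pi : T -> Theta -> R,
     is_contour pi ->
     measurable_contour pi ->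
     valid P pi ->
     possibilistically_unbiased P pi ->
     [/\ measurable_membership (alpha_cut pi),
         nested P (alpha_cut pi),
         nominal_coverage P (alpha_cut pi)
       & unbiased_sets P (alpha_cut pi)]).
Proof.
split=> [C mC mS nC cov uC lc|pi cpi mpi vpi upi].
  have cut0 x vartheta : alpha_cut (stacked C) 0 x vartheta.
    by have /andP[] := stacked_itv C x vartheta.
  split.
  - by move=> x vartheta; exact: stacked_itv.
  - move=> vartheta theta.
    apply: filterS (alpha_cut_stacked_ae nC (lc vartheta theta)).
    move=> x cutx alpha /andP[alpha0 alpha1] C0.
    have [alpha_eq0|alpha_neq0] := eqVneq alpha 0.
      by rewrite alpha_eq0; split=> // _; exact: C0.
    by apply: cutx; rewrite lt_neqAle eq_sym alpha_neq0 alpha0.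
  - move=> theta lcT.
    apply: filterS2 (nested_rational_ae theta nC) lcT => x nx lcx.
    move=> alpha /andP[alpha0 alpha1] C0.
    have [alpha_eq0|alpha_neq0] := eqVneq alpha 0.
      by rewrite alpha_eq0 C0//; apply/seteqP; split.
    rewrite eqEsubset; split=> vartheta; apply alpha_cut_stackedP => //;
      rewrite ?[0 < _]lt_neqAle ?[0 == _]eq_sym ?alpha_neq0 ?alpha0//;
      apply: rational_nested_monotone => // q1 q2 l1 l2 q12; exact: nx.
  - by apply: stacked_valid => // theta; exact: lc.
  - exact: stacked_unbiased.
split.
- by move=> alpha theta _; exact: measurable_set_ger.
- exact: alpha_cut_nested.
- exact: alpha_cut_coverage.
- exact: alpha_cut_unbiased.
Qed.
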